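(* Let $S$ be a positive pseudocomplemented semiring. Then the following statements are equivalent: (1) $S$ is a Stone semiring. (2) $(st)^* = s^* + t^*$ for any $s,t \in S$, and $1\in \operatorname{Stone}(S)$.
   Context: A semiring is a set $S$ with operations $+,\cdot$ such that $(S,+)$ is a commutative monoid with identity $0$, $(S,\cdot)$ is a commutative monoid with identity $1\neq 0$, multiplication distributes over addition, and $s\cdot 0=0$ for all $s\in S$. An ordered semiring is a semiring with a partial order $\leq$ such that $s\leq t$ implies $s+u\leq t+u$ for all $u$, and $s\leq t$, $0\leq u$ imply $su\leq tu$. It is positive if $0\leq s$ for all $s\in S$. In an ordered semiring $S$, an element $s$ is pseudocomplemented if there is an element $s^*\in S$ (necessarily unique, called the pseudocomplement of $s$) such that $ss^*=0$ and, for each $x\in S$, $sx=0$ implies $x\leq s^*$. $\operatorname{pcomp}(S)$ is the set of pseudocomplemented elements of $S$, and $S$ is a pseudocomplemented semiring if $S=\operatorname{pcomp}(S)$. Write $s^{**}=(s^* )^*$ when it exists. For $S$ positive, $s\in S$ is a Stone element if $s,s^*\in\operatorname{pcomp}(S)$ and $s^*+s^{**}=1$; $\operatorname{Stone}(S)$ is the set of Stone elements, and $S$ is a Stone semiring if $S=\operatorname{Stone}(S)$. *)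

(* Defs.v *)
From HB Require Import structures.
From mathcomp Require Import all_boot ssralg.
From mathcomp Require Import boolp classical_sets.
Set Implicit Arguments.
Unset Strict Implicit.
Unset Printing Implicit Defensive.
Import GRing.Theory.
Local Open Scope ring_scope.

(* MathComp's ordered algebraic structures start at porderZmodType, and
   Hierarchy Builder rejects a later join of POrder with a semiring structure
   (the join of POrder and nmodType is missing), so the order is a field of
   this mixin.  In comNzSemiRingType multiplication is commutative and
   1 != 0. *)
HB.mixin Record isOrderedSemiRing S of GRing.ComNzSemiRing S := {
  sle : rel S;
  sle_refl : reflexive sle;
  sle_anti : antisymmetric sle;
  sle_trans : transitive sle;
  sle_addr : forall s t u : S, sle s t -> sle (s + u) (t + u);
  sle_mulr : forall s t u : S, sle s t -> sle 0 u -> sle (s * u) (t * u)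
}.

#[short(type="orderedSemiRingType")]
HB.structure Definition OrderedSemiRing :=
  { S of isOrderedSemiRing S & GRing.ComNzSemiRing S }.

(* This scope shadows the order and the complex conjugation of ring_scope. *)
Declare Scope ordered_semiring_scope.
Delimit Scope ordered_semiring_scope with OS.
Local Open Scope ordered_semiring_scope.

Notation "s <= t" := (sle s t) : ordered_semiring_scope.

Definition positive_semiring (S : orderedSemiRingType) : Prop :=
  forall s : S, 0 <= s.

Definition is_pcompl (S : orderedSemiRingType) (s t : S) : Prop :=
  s * t = 0 /\ forall x : S, s * x = 0 -> x <= t.

Lemma is_pcompl_unique (S : orderedSemiRingType) (s t u : S) :
  is_pcompl s t -> is_pcompl s u -> t = u.
Proof.
move=> [st0 tmax] [su0 umax]; apply: sle_anti.
by rewrite umax // tmax.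
Qed.

Definition pcomplemented (S : orderedSemiRingType) : set S :=
  [set s | exists t : S, is_pcompl s t]%classic.
Arguments pcomplemented S : clear implicits.

Definition pseudocomplemented_semiring (S : orderedSemiRingType) : Prop :=
  pcomplemented S = [set: S]%classic.

(* Total function: the value is the pseudocomplement of s if s is
   pseudocomplemented, and the junk value 0 otherwise. *)
Definition pcompl (S : orderedSemiRingType) (s : S) : S :=
  xget 0 [set t | is_pcompl s t]%classic.

Lemma pcomplP (S : orderedSemiRingType) (s : S) :
  pcomplemented S s -> is_pcompl s (pcompl s).
Proof. by move=> [t st]; apply: (xgetI _ st). Qed.

Notation "s ^*" := (pcompl s) : ordered_semiring_scope.

Definition Stone (S : orderedSemiRingType) : set S :=
  [set s | [/\ pcomplemented S s, pcomplemented S (s^*) & s^* + s^*^* = 1]]%classic.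
Arguments Stone S : clear implicits.

Definition Stone_semiring (S : orderedSemiRingType) : Prop :=
  Stone S = [set: S]%classic.

(* Main.v *)
(* By distributivity, [x = s^* x + s^** x] in a Stone semiring; if [s t x = 0],
   the first summand is killed by [s], and the second by [t] because
   [t x <= s^*], so that [x <= s^* + t^*].  Conversely, applying (2) to [s s^* = 0] gives
   [s^* + s^** = 0^*], and [1] being a Stone element means [0^* = 1], since
   [1^* = 0]. *)
Require Import Defs.
From mathcomp Require Import all_boot ssralg.
From mathcomp Require Import boolp classical_sets.
Local Open Scope ring_scope.
Local Open Scope ordered_semiring_scope.

Import GRing.Theory.

Lemma sle_add (S : orderedSemiRingType) (s t u v : S) :
  s <= t -> u <= v -> s + u <= t + v.
Proof.
move=> st uv; apply: (@sle_trans _ (t + u)); first exact: sle_addr.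
by rewrite ![t + _]addrC; apply: sle_addr.
Qed.

Lemma pcompl1 (S : orderedSemiRingType) :
  pcomplemented S 1 -> (1 : S)^* = 0.
Proof. by case/pcomplP; rewrite mul1r. Qed.

Lemma pcomplM_Stone (S : orderedSemiRingType) (s t : S) :
  positive_semiring S -> Stone S s -> pcomplemented S t ->
  pcomplemented S (s * t) -> (s * t)^* = s^* + t^*.
Proof.
move=> Spos [sP scP sE] tP stP.
have [ss0 smax] := pcomplP sP; have [tt0 tmax] := pcomplP tP.
have [stst0 stmax] := pcomplP stP.
apply: sle_anti; apply/andP; split; last first.
  by apply: stmax; rewrite mulrDr mulrAC ss0 mul0r -mulrA tt0 mulr0 addr0.
(* Split [(s * t)^*] along [1 = s^* + s^*^*]; the two products are bounded by [s^*] and [t^*]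
   respectively. *)
rewrite -[X in X <= _]mul1r -sE mulrDl; apply: sle_add.
  by apply: smax; rewrite mulrA ss0 mul0r.
have tx_le : t * (s * t)^* <= s^* by apply: smax; rewrite mulrA.
have [scc0 _] := pcomplP scP.
(* Multiplying [tx_le] by [s^*^*] bounds the product by [s^* * s^*^* = 0]; positivity makes it
   zero. *)
apply: tmax; rewrite mulrCA [_ * (t * _)]mulrC; apply: sle_anti.
rewrite Spos andbT -[X in _ <= X]scc0; exact: sle_mulr.
Qed.

Theorem proposition2p15 (S : orderedSemiRingType)
    (Spos : positive_semiring S) (Spc : pseudocomplemented_semiring S) :
  Stone_semiring S <->
  (forall s t : S, (s * t)^* = s^* + t^*) /\ (1 : S) \in Stone S.
Proof.
have pcS (s : S) : pcomplemented S s by rewrite Spc.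
split=> [StS | [pcomplM /set_mem[_ _ St1]]].
  have StoneS (s : S) : Stone S s by rewrite StS.
  by split=> [s t|]; [apply: pcomplM_Stone | apply/mem_set].
apply/seteqP; split=> // s _; split=> //.
have [ss0 _] := pcomplP (pcS s).
(* Both sides become [0^*]: the [1] on the right is expanded to [1^* + 1^*^*], where [1^* = 0]. *)
by rewrite -pcomplM ss0 -[RHS]St1 pcompl1 // add0r.
Qed.
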